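(* Let $\pi_0,\alpha\in\mathbb{R}$ and $\pi\in\mathbb{R}^n$. The inequality $$\pi_0+\pi^\top x\le\alpha w$$ is valid (respectively, facet-defining) for $\operatorname{conv}(X_0)$ if and only if the inequality $$\pi_0+\pi^\top x\le\alpha(w-b^\top x)$$ is valid (respectively, facet-defining) for $\operatorname{conv}(X)$.
   Context: Let $n,t$ be positive integers, $[n]=\{1,\dots,n\}$, $[t]=\{1,\dots,t\}$, $f:\mathbb{R}\to\mathbb{R}$ a concave function, $a\in\mathbb{R}^n$ with non-negative entries, $b\in\mathbb{R}^n$, and $\{N_k\}_{k\in[t]}$ a partition of $[n]$. Define $$X_0=\Big\{(w,x)\in\mathbb{R}\times\{0,1\}^n:\ w\ge f(a^\top x),\ \sum_{i\in N_k}x_i\le1\ \forall k\in[t]\Big\},$$ $$X=\Big\{(w,x)\in\mathbb{R}\times\{0,1\}^n:\ w\ge f(a^\top x)+b^\top x,\ \sum_{i\in N_k}x_i\le1\ \forall k\in[t]\Big\}.$$ *)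

(* Defs.v *)
From HB Require Import structures.
From mathcomp Require Import all_boot all_order all_algebra.
From mathcomp Require Import interval_inference.
From mathcomp Require Import boolp classical_sets reals convex.

Set Implicit Arguments.
Unset Strict Implicit.
Unset Printing Implicit Defensive.

Import Order.TTheory GRing.Theory Num.Theory.

Local Open Scope classical_set_scope.
Local Open Scope ring_scope.
Local Open Scope convex_scope.

Definition concave_function (R : realType) (f : R -> R) : Prop :=
  forall (t : {i01 R}) (x y : R^o),
    (f x : R^o) <| t |> f y <= f (x <| t |> y).

Definition conv_hull (R : realType) (V : lmodType R) (S : set V) : set V :=
  smallest (@convex_set R V) S.

Section AffineDimension.
Context {R : realType} {V : vectType R}.

Definition affinely_independent (s : seq V) : bool :=
  if s is x0 :: s' then free [seq x - x0 | x <- s'] else true.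

Lemma affinely_independent_size (s : seq V) :
  affinely_independent s -> (size s <= (\dim {:V}).+1)%N.
Proof.
case: s => [|x0 s] //= /eqP; rewrite size_map ltnS => <-.
exact: dimvS (subvf _).
Qed.

(* The maximum number of affinely independent points of S, minus one; hence -1
   if S is empty.  By affinely_independent_size, bounding the range of m by
   \dim {:V} + 1 loses nothing. *)
Definition affdim (S : set V) : int :=
  (\max_(m < (\dim {:V}).+2 |
      `[< exists s : seq V,
            [/\ size s = m, [set` s] `<=` S & affinely_independent s] >]) m)%:Z
  - 1.

(* An inequality in the variable z : V is given by its two sides,
   lhs z <= rhs z. *)
Definition valid_ineq (P : set V) (lhs rhs : V -> R) : Prop :=
  forall z, P z -> lhs z <= rhs z.

Definition ineq_face (P : set V) (lhs rhs : V -> R) : set V :=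
  P `&` [set z | lhs z = rhs z].

Definition facet_defining (P : set V) (lhs rhs : V -> R) : Prop :=
  valid_ineq P lhs rhs /\ affdim (ineq_face P lhs rhs) = affdim P - 1.

End AffineDimension.

Definition dotv (R : realType) (n : nat) (u v : 'cV[R]_n) : R :=
  (u^T *m v) 0 0.

(* The parts N k are nonempty, pairwise disjoint, and cover 'I_n; injectivity
   makes distinct indices denote distinct parts. *)
Definition is_partition_family (n t : nat) (N : 'I_t -> {set 'I_n}) : Prop :=
  injective N /\ finset.partition (N @: 'I_t) [set: 'I_n]%SET.

Section MixedBinarySets.
Context {R : realType} {n t : nat}.

Definition binary (x : 'cV[R]_n) : Prop := forall i, x i 0 = 0 \/ x i 0 = 1.

(* R^o is R as a vector space over itself, so that R^o * 'cV[R]_n is one. *)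
Definition X0 (f : R -> R) (a : 'cV[R]_n) (N : 'I_t -> {set 'I_n}) :
    set (R^o * 'cV[R]_n)%type :=
  [set wx | [/\ binary wx.2,
                f (dotv a wx.2) <= wx.1
              & forall k, \sum_(i in N k) wx.2 i 0 <= 1]].

Definition X (f : R -> R) (a b : 'cV[R]_n) (N : 'I_t -> {set 'I_n}) :
    set (R^o * 'cV[R]_n)%type :=
  [set wx | [/\ binary wx.2,
                f (dotv a wx.2) + dotv b wx.2 <= wx.1
              & forall k, \sum_(i in N k) wx.2 i 0 <= 1]].

End MixedBinarySets.

(* Main.v *)
(* The shear (w, x) |-> (w + b^T x, x) is a linear automorphism of R x R^n that
   pulls X back to X0 and the second inequality back to the first.  Convex
   hulls, faces and affine dimension all commute with linear automorphisms. *)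
Require Import Defs.
From HB Require Import structures.
From mathcomp Require Import all_boot all_order all_algebra.
From mathcomp Require Import boolp classical_sets reals convex.

Set Implicit Arguments.
Unset Strict Implicit.
Unset Printing Implicit Defensive.

Import Order.TTheory GRing.Theory Num.Theory.

Local Open Scope classical_set_scope.
Local Open Scope ring_scope.

(** An injective [g] has zero kernel, so it preserves the dimension of the span of [s], and freeness
    only compares that dimension with [size s]. *)
Lemma free_map_linear (K : fieldType) (V W : vectType K) (g : {linear V -> W})
    (s : seq V) :
  injective g -> free [seq g x | x <- s] = free s.
Proof.
move=> g_inj.
have kerg0 : lker (linfun g) == 0%VS.
  by apply/lker0P => x y; rewrite !lfunE; apply: g_inj.
have -> : [seq g x | x <- s] = [seq linfun g x | x <- s].
  by apply: eq_map => x; rewrite lfunE.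
by rewrite /free -limg_span limg_dim_eq ?size_map// (eqP kerg0) capv0.
Qed.

Section LinearPreimage.
Context {R : realType}.

Lemma affinely_independent_map (V W : vectType R) (g : {linear V -> W})
    (s : seq V) :
  injective g ->
  affinely_independent [seq g x | x <- s] = affinely_independent s.
Proof.
case: s => [//|x0 s] g_inj /=; rewrite -(free_map_linear _ g_inj) -!map_comp.
by congr free; apply: eq_map => x /=; rewrite linearB.
Qed.

Lemma affdim_le (V W : vectType R) (S : set V) (T : set W) :
  (forall s : seq V, [set` s] `<=` S -> affinely_independent s ->
     exists s' : seq W,
       [/\ size s' = size s, [set` s'] `<=` T & affinely_independent s']) ->
  affdim S <= affdim T.
Proof.
move=> ST; rewrite lerD2r lez_nat; apply/bigmax_leqP => m /asboolP[s [sm sS si]].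
have [s' [s's s'T s'i]] := ST s sS si.
(* The maximum for [T] has its own cut-off, depending on [W] rather than [V]; the transported family
   [s'] lives in [W], so its size [m] is within that range. *)
have mW : (m < (\dim {:W}).+2)%N.
  by rewrite ltnS -sm -s's affinely_independent_size.
rewrite (leq_bigmax_cond (Ordinal mW))//.
by apply/asboolP; exists s'; rewrite s's.
Qed.

Lemma affdim_preimage (V W : vectType R) (g : {linear V -> W}) (S : set W) :
  bijective g -> affdim (g @^-1` S) = affdim S.
Proof.
move=> g_bij; have g_inj := bij_inj g_bij; case: g_bij => h gK hK.
apply/le_anti/andP; split; apply: affdim_le => s sS si.
  exists [seq g x | x <- s]; rewrite size_map affinely_independent_map//.
  by split=> // _ /mapP[x xs ->]; apply: sS.
exists [seq h y | y <- s]; rewrite size_map; split=> //.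
  by move=> _ /mapP[y ys ->]; rewrite /preimage/= hK; apply: sS.
(* The inverse [h] is a bare function with no linear structure at hand, so independence of the
   [h]-image is checked after applying [g], which gives back [s]. *)
by rewrite -(affinely_independent_map _ g_inj) mapK.
Qed.

Lemma convex_set_preimage (V W : lmodType R) (g : {linear V -> W})
    (A : set W) :
  convex_set A -> convex_set (g @^-1` A).
Proof.
move=> cA x y l; rewrite !inE => xA yA.
have := cA (g x) (g y) l (mem_set xA) (mem_set yA).
by rewrite inE /conv /= -!linearZ -linearD.
Qed.

Lemma convex_set_image (V W : lmodType R) (g : {linear V -> W}) (A : set V) :
  convex_set A -> convex_set (g @` A).
Proof.
move=> cA _ _ l /set_mem[x xA <-] /set_mem[y yA <-]; apply: mem_set.
exists (conv l (x : convex_lmodType V) (y : convex_lmodType V)).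
  by apply: set_mem; apply: cA; apply: mem_set.
by rewrite /conv /= linearD !linearZ.
Qed.

(** Each inclusion tests a hull against a transported convex set: the preimage under [g] of a convex
    set containing [S], then the image under [g] of a convex set containing the preimage of [S].
    Surjectivity puts [S] inside that image, and injectivity brings the point back. *)
Lemma conv_hull_preimage (V W : lmodType R) (g : {linear V -> W}) (S : set W) :
  bijective g -> conv_hull (g @^-1` S) = g @^-1` conv_hull S.
Proof.
move=> g_bij; have g_inj := bij_inj g_bij; case: g_bij => h gK hK.
apply/seteqP; split=> z.
  move=> zS A [cA SA]; apply: (zS (g @^-1` A)); split.
    exact: convex_set_preimage.
  by move=> x; apply: SA.
move=> gzS A [cA SA]; have [|x xA /g_inj <-//] := gzS (g @` A); split.
  exact: convex_set_image.
by move=> y yS; exists (h y) => //; apply: SA; rewrite /preimage/= hK.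
Qed.

Lemma valid_ineq_preimage (V W : vectType R) (g : V -> W) (P : set W)
    (l r : W -> R) :
  bijective g ->
  valid_ineq (g @^-1` P) (l \o g) (r \o g) <-> valid_ineq P l r.
Proof.
case=> h _ hK; split=> lr z Pz; last exact: lr.
by have := lr (h z); rewrite /preimage /= hK; apply.
Qed.

Lemma facet_defining_preimage (V W : vectType R) (g : {linear V -> W})
    (P : set W) (l r : W -> R) :
  bijective g ->
  facet_defining (g @^-1` P) (l \o g) (r \o g) <-> facet_defining P l r.
Proof.
move=> g_bij; rewrite /facet_defining (affdim_preimage _ g_bij).
(* The face cut out by the composed inequality is, by conversion, the preimage of the face of [P],
   so the two dimension equations now coincide. *)
rewrite -[affdim (ineq_face P l r)](affdim_preimage _ g_bij).
by split=> -[/(valid_ineq_preimage _ _ _ g_bij) ? ?].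
Qed.

End LinearPreimage.

Section Shear.
Context {R : realType} {n : nat}.

Definition shear (b : 'cV[R]_n) (z : R^o * 'cV[R]_n) : R^o * 'cV[R]_n :=
  (z.1 + dotv b z.2, z.2).

Lemma shear_is_linear b : linear (shear b).
Proof.
move=> k u v; congr pair; rewrite /= /dotv mulmxDr -scalemxAr !mxE.
by rewrite scalerDr addrACA.
Qed.

HB.instance Definition _ b :=
  GRing.isLinear.Build R _ _ _ (shear b) (shear_is_linear b).

Lemma shear_bij b : bijective (shear b).
Proof.
by exists (fun z => (z.1 - dotv b z.2, z.2)) => -[w x];
  rewrite /shear /= ?addrK ?subrK.
Qed.

Lemma X0_preimage_shear t f a b (N : 'I_t -> {set 'I_n}) :
  X0 f a N = shear b @^-1` X f a b N.
Proof.
by apply/seteqP; split=> -[w x] [/= xbin fw xN]; split;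
  rewrite //= ?lerD2r// -(lerD2r (dotv b x)).
Qed.

End Shear.

Theorem theorem6p3 (R : realType) (n t : nat) (hn : (0 < n)%N) (ht : (0 < t)%N)
  (f : R -> R) (hf : concave_function f)
  (a : 'cV[R]_n) (ha : forall i, 0 <= a i 0)
  (b : 'cV[R]_n)
  (N : 'I_t -> {set 'I_n}) (hN : is_partition_family N)
  (pi0 alpha : R) (p : 'cV[R]_n) :
  (valid_ineq (conv_hull (X0 f a N))
     (fun wx => pi0 + dotv p wx.2) (fun wx => alpha * wx.1)
   <->
   valid_ineq (conv_hull (X f a b N))
     (fun wx => pi0 + dotv p wx.2) (fun wx => alpha * (wx.1 - dotv b wx.2)))
  /\
  (facet_defining (conv_hull (X0 f a N))
     (fun wx => pi0 + dotv p wx.2) (fun wx => alpha * wx.1)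
   <->
   facet_defining (conv_hull (X f a b N))
     (fun wx => pi0 + dotv p wx.2) (fun wx => alpha * (wx.1 - dotv b wx.2))).
Proof.
(* Both sides of the first inequality are rewritten as composites with [shear b], the form the
   preimage lemmas expect. On the right the added [dotv b wx.2] cancels; the left side depends only
   on [wx.2], which the shear fixes. *)
have -> : (fun wx : R^o * 'cV[R]_n => alpha * wx.1) =
    (fun wx => alpha * (wx.1 - dotv b wx.2)) \o shear b.
  by apply/funext => wx /=; rewrite addrK.
have -> : (fun wx : R^o * 'cV[R]_n => pi0 + dotv p wx.2) =
    (fun wx => pi0 + dotv p wx.2) \o shear b by [].
rewrite (X0_preimage_shear f a b) (conv_hull_preimage _ (shear_bij b)).
split; first exact/valid_ineq_preimage/shear_bij.
exact/facet_defining_preimage/shear_bij.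
Qed.
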